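(* Let $S$ be an additively divisible (commutative) semiring generated, as a semiring, by a single element $w\in S$. If $S$ has no multiplicatively neutral element, then there exists $a\in S\cup\{0\}$ such that the set $\{u+au : u\in S\}$ is an ideal of $S$ consisting of (additively) idempotent elements.
   Context: A semiring is a non-empty set with two commutative and associative binary operations, addition and multiplication, such that multiplication distributes over addition; no additively or multiplicatively neutral element is assumed. $\mathbb{N}$ denotes the positive integers; for $a\in S$ and $k\in\mathbb{N}$, $ka$ is the sum of $k$ copies of $a$. $S$ is additively divisible if for every $a\in S$ and every $n\in\mathbb{N}$ there is $b\in S$ with $a=nb$. In $S\cup\{0\}$, the symbol $0$ is a formally adjoined element with $x+0=0+x=x$ and $x\cdot 0=0\cdot x=0$ for all $x\in S\cup\{0\}$; thus for $a=0$ one has $u+au=u$. An element $e$ is idempotent if $e+e=e$. An ideal of $S$ is a non-empty subset $I\subseteq S$ with $x+y\in I$ and $sx\in I$ for all $x,y\in I$, $s\in S$. *)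

(* Defs.v *)
From HB Require Import structures.
From mathcomp Require Import all_boot.
From mathcomp Require Import boolp classical_sets.

Set Implicit Arguments.
Unset Strict Implicit.
Unset Printing Implicit Defensive.

(* Addition is written in ring_scope and multiplication in group_scope. *)
Local Open Scope classical_set_scope.
Local Open Scope group_scope.
Local Open Scope ring_scope.

(* Commutative semirings in which neither a zero nor a one is assumed; the
   library's semirings (GRing.PzSemiRing) always have both.  Non-emptiness is not part
   of the structure: it follows from the existence of a generator. *)
HB.mixin Record AddSemigroup_isSemiring S
    of Algebra.AddSemigroup S & Semigroup S := {
  semiring_mulC : commutative (@mul S);
  semiring_mulDl : left_distributive (@mul S) (@Algebra.add S)
}.

#[short(type="semiringType")]
HB.structure Definition Semiring :=
  {S of AddSemigroup_isSemiring S & Algebra.AddSemigroup S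
      & Semigroup S}.

(* The sum of k copies of a, for k > 0 (the value at k = 0 is junk).  The
   library's [a *+ k] requires a zero. *)
Definition pmuln (S : semiringType) (a : S) (k : nat) : S :=
  iterop k (@Algebra.add S) a a.

Definition additively_divisible (S : semiringType) : Prop :=
  forall (a : S) (n : nat), (0 < n)%N -> exists b : S, a = pmuln b n.

Definition subsemiring (S : semiringType) (A : set S) : Prop :=
  [/\ A !=set0,
      forall x y, A x -> A y -> A (x + y)
    & forall x y, A x -> A y -> A (x * y)].

Definition generated_by (S : semiringType) (w : S) : Prop :=
  smallest (@subsemiring S) [set w] = setT.

Definition has_mul_neutral (S : semiringType) : Prop :=
  exists e : S, left_id e (@mul S) /\ right_id e (@mul S).

Definition add_idempotent (S : semiringType) (e : S) : Prop := e + e = e.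

Definition is_ideal (S : semiringType) (I : set S) : Prop :=
  [/\ I !=set0,
      forall x y, I x -> I y -> I (x + y)
    & forall s x, I x -> I (s * x)].

(* [option S] encodes S with a formally adjoined zero [None]; it is new even if
   S already has an additively neutral element. *)
Definition add0 (S : semiringType) (x y : option S) : option S :=
  match x, y with
  | None, _ => y
  | _, None => x
  | Some x', Some y' => Some (x' + y')
  end.

Definition mul0 (S : semiringType) (x y : option S) : option S :=
  match x, y with
  | Some x', Some y' => Some (x' * y')
  | _, _ => None
  end.

(* The set {u + au : u in S}, as a subset of S. *)
Definition plus_mul_set (S : semiringType) (a : option S) : set S :=
  [set x | exists u : S, Some x = add0 (Some u) (mul0 a (Some u))].

(* Main.v *)
(** Write every element of [S] as [w * s] or as [w * (k + c)] with [k > 0] a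
    natural number and [c] in [S] or zero.  If [w = n (w * s)], then [n s] is
    multiplicatively neutral; hence, for every [n], divisibility gives
    [1 = n (k + c)], read as an identity of operators applied to [w].  For
    [n = 2] this is [1 = 1 + p] with [p = m + c], [m = 2k - 1 > 0], and
    replacing a summand [1] of [p] by [1 + p] yields [p = p + p].  For [n = m]
    we get [1 = m q] with [q = k' + c'], and then [q p = 1 + q c] is again
    idempotent, so [a = q c] works. *)
Require Import Defs.
From mathcomp Require Import all_boot.
From mathcomp Require Import boolp classical_sets.

Set Implicit Arguments.
Unset Strict Implicit.
Unset Printing Implicit Defensive.

Import Algebra.

Local Open Scope classical_set_scope.
Local Open Scope group_scope.
Local Open Scope ring_scope.

Local Arguments pmuln : simpl never.

Section Multiples.
Variable S : semiringType.
Implicit Types (a b x y : S) (k n : nat) (c : option S).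

Lemma semiring_mulDr : right_distributive (@mul S) (@Algebra.add S).
Proof. by move=> x y z; rewrite !(semiring_mulC x) semiring_mulDl. Qed.

Lemma pmulnS a k : pmuln a k.+2 = a + pmuln a k.+1.
Proof. by []. Qed.

Lemma pmuln_additive (f : S -> S) a k :
  {morph f : x y / x + y} -> f (pmuln a k.+1) = pmuln (f a) k.+1.
Proof. by move=> fD; elim: k => // k IH; rewrite !pmulnS fD IH. Qed.

Lemma pmuln_mull a b k : pmuln (a * b) k.+1 = pmuln a k.+1 * b.
Proof.
by rewrite (pmuln_additive (f := fun x => x * b)) // => x y; exact: semiring_mulDl.
Qed.

Lemma pmulnDl a j k : pmuln a (j.+1 + k.+1) = pmuln a j.+1 + pmuln a k.+1.
Proof.
elim: j => [|j IH]; first by rewrite add1n pmulnS.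
by rewrite addSn addSn pmulnS -addSn IH addrA -pmulnS.
Qed.

Lemma pmulnDr k : {morph (fun x => pmuln x k.+1) : x y / x + y}.
Proof. by move=> x y; elim: k => // k IH; rewrite !pmulnS IH addrACA. Qed.

Lemma pmuln_pmuln a j k : pmuln (pmuln a j.+1) k.+1 = pmuln a (k.+1 * j.+1).
Proof.
by elim: k => [|k IH]; rewrite ?mul1n // pmulnS IH mulSn [in RHS]mulSn pmulnDl.
Qed.

Lemma pmuln_absorb x y k : x + y = x -> pmuln x k.+1 + y = pmuln x k.+1.
Proof. by move=> xy; case: k => // k; rewrite pmulnS addrAC xy. Qed.

(* The operator [k + 1 + c]; the shift keeps the integer part positive. *)
Definition scale k c x : S :=
  if c is Some s then pmuln x k.+1 + s * x else pmuln x k.+1.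

Lemma scaleD k c : {morph scale k c : x y / x + y}.
Proof.
by case: c => [s|] x y /=; rewrite pmulnDr // semiring_mulDr addrACA.
Qed.

Lemma scale_mull k c x y : scale k c (x * y) = scale k c x * y.
Proof.
by case: c => [s|] /=; rewrite pmuln_mull // mulgA semiring_mulDl.
Qed.

Lemma scale_mulr k c x y : scale k c (x * y) = x * scale k c y.
Proof. by rewrite semiring_mulC scale_mull semiring_mulC. Qed.

(** The integer part [k.+1] is positive, so [x] itself is a summand of [scale k c x], and that
    summand absorbs [y]. *)
Lemma scale_absorb k c x y : x + y = x -> scale k c x + y = scale k c x.
Proof.
by move=> xy; case: c => [s|] /=; [rewrite addrAC|];
   rewrite (pmuln_absorb _ xy).
Qed.

Lemma pmuln_scale k c x n :
  exists c', pmuln (scale k c x) n.+1 = scale (n.+1 * k.+1).-1 c' x.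
Proof.
case: c => [s|] /=.
  by exists (Some (pmuln s n.+1)); rewrite pmulnDr pmuln_pmuln /= -pmuln_mull.
by exists None; rewrite pmuln_pmuln.
Qed.

Lemma scaleS k c x : scale k.+1 c x = x + scale k c x.
Proof. by case: c => [s|] //=; rewrite pmulnS addrA. Qed.

Lemma add_idempotent_additive (f : S -> S) x :
  {morph f : y z / y + z} -> add_idempotent x -> add_idempotent (f x).
Proof. by move=> fD xx; rewrite /add_idempotent -fD xx. Qed.

Lemma plus_mul_setP c x : plus_mul_set c x <-> exists u, x = scale 0 c u.
Proof.
by case: c => [s|]; split=> [] [u e]; exists u; move: e => /= [->].
Qed.

(** The set is the image of [scale 0 c], a map that is additive and commutes with multiplication by
    any element; the argument in [S] witnesses non-emptiness. *)
Lemma plus_mul_set_ideal c : S -> is_ideal (plus_mul_set c).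
Proof.
move=> x0; split.
- by exists (scale 0 c x0); apply/plus_mul_setP; exists x0.
- move=> x y /plus_mul_setP[u ->] /plus_mul_setP[v ->].
  by apply/plus_mul_setP; exists (u + v); rewrite scaleD.
- move=> s x /plus_mul_setP[u ->].
  by apply/plus_mul_setP; exists (s * u); rewrite scale_mulr.
Qed.

End Multiples.

Section OneGenerated.
Variables (S : semiringType) (w : S).
Hypothesis Sgen : generated_by w.

Lemma generated_ind (A : set S) : subsemiring A -> A w -> forall u, A u.
Proof.
move=> Asub Aw u.
have : smallest (@subsemiring S) [set w] u by rewrite Sgen.
by apply; split=> // x ->.
Qed.

(** Elements of these two shapes form a subsemiring containing [w]: in a mixed sum, [w * s] is
    merged into the part [c], and every product has a factor [w] to pull out. *)
Lemma generated_form (u : S) :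
  (exists s, u = w * s) \/ (exists k c, u = scale k c w).
Proof.
move: u; apply: generated_ind; last by right; exists 0, None.
split; first by exists w; right; exists 0, None.
- move=> _ _ [[s ->]|[k [c ->]]] [[t ->]|[l [d ->]]].
  + by left; exists (s + t); rewrite semiring_mulDr.
  + right; exists l; case: d => [d|] /=.
      by exists (Some (s + d)) => /=;
         rewrite addrCA semiring_mulDl (semiring_mulC s).
    by exists (Some s) => /=; rewrite addrC (semiring_mulC s).
  + right; exists k; case: c => [c|] /=.
      by exists (Some (c + t)) => /=;
         rewrite -addrA semiring_mulDl (semiring_mulC t).
    by exists (Some t) => /=; rewrite (semiring_mulC t).
  (* The integer parts [k.+1] and [l.+1] add up to [(k + l.+1).+1]. *)
  + right; exists (k + l.+1)%N; case: c d => [c|] [d|] /=.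
    * by exists (Some (c + d)) => /=;
         rewrite -addSn pmulnDl semiring_mulDl addrACA.
    * by exists (Some c) => /=; rewrite -addSn pmulnDl addrAC.
    * by exists (Some d) => /=; rewrite -addSn pmulnDl addrA.
    * by exists None => /=; rewrite -addSn pmulnDl.
- move=> _ y [[s ->]|[k [c ->]]] _; left.
    by exists (s * y); rewrite mulgA.
  by exists (scale k c y); rewrite -scale_mull scale_mulr.
Qed.

(** The elements fixed by multiplication by [e] form a subsemiring, which is all of [S] once it
    contains [w]. *)
Lemma generator_stable_neutral (e : S) : w * e = w -> has_mul_neutral S.
Proof.
move=> we; suff eP u : u * e = u.
  by exists e; split=> u //; rewrite semiring_mulC.
move: u; apply: generated_ind => //; split; first by exists w.
- by move=> x y xe ye; rewrite semiring_mulDl xe ye.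
- by move=> x y _ ye; rewrite -mulgA ye.
Qed.

(** The elements that the operator sends to idempotents are closed under sums and products, so
    testing [w] suffices. *)
Lemma scale_idempotent k c :
  add_idempotent (scale k c w) -> forall u, add_idempotent (scale k c u).
Proof.
move=> we; apply: generated_ind => //; split; first by exists w.
- by move=> x y xi yi; rewrite /add_idempotent scaleD addrACA xi yi.
- move=> x y xi _; rewrite scale_mull.
  by apply: (add_idempotent_additive (f := fun z => z * y)) => // a b;
     exact: semiring_mulDl.
Qed.

Lemma generator_divisible n :
  additively_divisible S -> ~ has_mul_neutral S ->
  exists k c, w = pmuln (scale k c w) n.+1.
Proof.
move=> Sdiv Sno1; have [b wb] := Sdiv w n.+1 isT.
have [[s bE]|[k [c bE]]] := generated_form b; last first.
  by exists k, c => /=; rewrite -bE.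
case: Sno1; apply: (@generator_stable_neutral (pmuln s n.+1)).
by rewrite semiring_mulC -pmuln_mull semiring_mulC -bE.
Qed.

End OneGenerated.

Theorem theorem4p7 (S : semiringType) (w : S)
    (Sdiv : additively_divisible S)
    (Sgen : generated_by w)
    (Sno1 : ~ has_mul_neutral S) :
  exists a : option S,
    is_ideal (plus_mul_set a)
    /\ (forall x : S, plus_mul_set a x -> add_idempotent x).
Proof.
have [k [c0]] := generator_divisible Sgen 1 Sdiv Sno1.
have [c ->] := pmuln_scale k c0 w 1.
(* The integer part is now [2 * k.+1]; splitting off one copy of [w] leaves [p = scale k.*2 c],
   whose integer part is [m = k.*2.+1]. *)
rewrite mul2n doubleS /= scaleS => /esym wp.
have pp : add_idempotent (scale k.*2 c w) by exact: scale_absorb.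
have [l [d wq]] := generator_divisible Sgen k.*2 Sdiv Sno1.
(* This is [q c] for [q = scale l d]; it stays zero when [c] is zero. *)
pose a := omap (scale l d) c.
have qp : scale l d (scale k.*2 c w) = scale 0 a w.
  (* Additivity of [q] turns the integer part of [p] into [m q], which sends [w] to [w] by [wq]. *)
  rewrite /a; case: (c) => [s|] /=; last first.
    by rewrite (pmuln_additive _ _ (@scaleD _ l d)) -wq.
  by rewrite scaleD (pmuln_additive _ _ (@scaleD _ l d)) -wq scale_mull.
exists a; split; first exact: plus_mul_set_ideal.
move=> _ /plus_mul_setP[u ->]; apply: (scale_idempotent Sgen).
by rewrite -qp; apply: add_idempotent_additive pp; exact: scaleD.
Qed.
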